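(* Let $G=(V,E)$ be a finite connected graph, and consider the Arboreal Gas on $G$ with uniform parameter $\beta>0$. Then there exists $\beta_0=\beta_0(G)>0$ such that for every $\beta\ge\beta_0$ and every pair of distinct adjacent edges $e_1,e_2\in E$, $$\mathbb{P}_\beta[e_1e_2]\le \mathbb{P}_\beta[e_1]\,\mathbb{P}_\beta[e_2].$$
   Context: A forest on $G$ is a subgraph (identified with its set of edges) containing no cycle; $\mathcal{F}$ is the set of all forests on $G$. The Arboreal Gas with uniform parameter $\beta>0$ is the probability measure on $\mathcal F$ given by $\mathbb{P}_\beta[F]=\frac{1}{Z_\beta}\beta^{|F|}$, with $Z_\beta=\sum_{F\in\mathcal F}\beta^{|F|}$, where $|F|$ is the number of edges of $F$. For edges $e_1,\dots,e_k$, $\mathbb{P}_\beta[e_1\cdots e_k]$ denotes the probability that all of $e_1,\dots,e_k$ belong to the random forest. Two edges are adjacent if they share an endpoint. *)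

(* Defs.v *)
From HB Require Import structures.
From mathcomp Require Import all_boot all_order all_algebra.
From mathcomp Require Import boolp reals.
Set Implicit Arguments.
Unset Strict Implicit.
Unset Printing Implicit Defensive.
Import Order.TTheory GRing.Theory Num.Theory.
Local Open Scope ring_scope.

(* Finite undirected graphs.  Parallel edges and loops are allowed (a loop has
   a one-element set of endpoints); a simple graph is the case where [ends] is
   injective with all values of cardinal 2. *)
Record graph := Graph {
  vertex : finType;
  edge : finType;
  ends : edge -> {set vertex};
  ends_card : forall e, (1 <= #|ends e| <= 2)%N
}.

Section Graph.
Variable G : graph.
Implicit Types (x y : vertex G) (e : edge G) (F S : {set edge G}).

Definition joins e x y : bool := ends e == [set x; y].

Definition connected_graph : Prop :=
  forall x y, connect (fun u v => [exists e, joins e u v]) x y.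

Definition adjacent e1 e2 : bool := ends e1 :&: ends e2 != set0.

(* The closed walk x_0 e_0 x_1 e_1 ... x_k e_k x_0 is encoded by the sequence
   of pairs (x_i, e_i).  Distinctness of the edges matters only for k = 1,
   where it excludes traversing one edge back and forth; k = 0 is a loop. *)
Definition is_cycle (c : seq (vertex G * edge G)) : Prop :=
  [/\ c != [::], cycle (fun p q => joins p.2 p.1 q.1) c,
      uniq (map fst c) & uniq (map snd c)].

Definition is_forest F : Prop :=
  forall c, is_cycle c -> ~ {subset map snd c <= F}.

Definition forests : {set {set edge G}} := [set F | `[< is_forest F >]].

Section ArborealGas.
Variables (R : realType) (beta : R).

Definition partition_function : R := \sum_(F in forests) beta ^+ #|F|.

Definition gas_mass F : R :=
  if F \in forests then beta ^+ #|F| / partition_function else 0.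

Definition gas_prob (A : {set {set edge G}}) : R := \sum_(F in A) gas_mass F.

Definition prob_edges S : R := gas_prob [set F : {set edge G} | S \subset F].

End ArborealGas.
End Graph.

(* Main.v *)
Require Import Defs.
From HB Require Import structures.
From mathcomp Require Import all_boot all_order all_algebra.
From mathcomp Require Import polyrcf ring.
From mathcomp Require Import boolp reals.
Set Implicit Arguments.
Unset Strict Implicit.
Unset Printing Implicit Defensive.
Import Order.TTheory GRing.Theory Num.Theory.
Local Open Scope ring_scope.

(* Write e1 = xy, e2 = xz, H = E - {e1, e2}, and let P_A be the beta-weighted sum
   over the forests of H in which the vertices of A lie in distinct trees.
   Conditioning on e1 and e2 reduces the claim to P_xyz P_x <= P_xy P_xz.
   - If x and y are not connected in H, then P_xy = P_x and P_xyz <= P_xz.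
   - If x separates y from z in H, forests split at x and equality holds.
   - Otherwise H is connected and the leading coefficient of
     P_xy P_xz - P_xyz P_x in beta is strictly positive. Indeed the leading
     coefficient T_A of P_A counts the spanning forests rooted at A, which by the
     matrix-tree theorem is a principal minor of the Laplacian of H. By Cramer's
     rule T_xz = T_x g(z) and T_xyz = T_xy g'(z), where g and g' are the Green
     functions with pole z grounded at {x} and at {x, y}, and the maximum
     principle gives g'(z) < g(z) because some path joins y to z avoiding x. *)

(** * Connectivity through an edge set, and acyclicity under adding an edge *)

Section Connectivity.
Variable G : graph.
Implicit Types (a b u v w x y z : vertex G) (e : edge G).
Implicit Types (F H : {set edge G}) (A : {set vertex G}).

Definition adj_in F u v := [exists e in F, joins e u v].
Definition conn F := connect (adj_in F).

Lemma joinsC e u v : joins e u v = joins e v u.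
Proof. by rewrite /joins setUC. Qed.

Lemma adj_inC F u v : adj_in F u v = adj_in F v u.
Proof. by apply: eq_existsb => e; rewrite joinsC. Qed.

Lemma connC F u v : conn F u v = conn F v u.
Proof. exact: (sym_connect_sym (adj_inC F)). Qed.

Lemma conn_trans F : transitive (conn F).
Proof. exact: connect_trans. Qed.

Lemma conn_refl F u : conn F u u.
Proof. exact: connect0. Qed.

Lemma conn_edge F e u v : e \in F -> joins e u v -> conn F u v.
Proof. by move=> eF euv; apply: connect1; apply/existsP; exists e; rewrite eF. Qed.

Lemma conn_ind F (P : vertex G -> Prop) u v :
    (forall e a b, e \in F -> joins e a b -> P a -> P b) ->
  conn F u v -> P u -> P v.
Proof.
move=> step /connectP[p pp ->]; elim: p u pp => //= w p IH u.
by case/andP=> /existsP[e /andP[eF euw]] pp Pu; apply: IH => //; exact: step eF euw Pu.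
Qed.

(** The vertex map [h] is the identity for monotonicity in the edge set, and later the contraction
    of one side of a cut vertex. *)
Lemma conn_map F F' (h : vertex G -> vertex G) u v :
    (forall e a b, e \in F -> joins e a b -> conn F' (h a) (h b)) ->
  conn F u v -> conn F' (h u) (h v).
Proof.
move=> step uv; apply: (conn_ind (P := fun w => conn F' (h u) (h w)) _ uv).
  by move=> e a b eF eab /conn_trans; apply; apply: step eab.
exact: conn_refl.
Qed.

Lemma conn_sub F F' u v : F \subset F' -> conn F u v -> conn F' u v.
Proof.
move=> /subsetP sFF'; apply: (@conn_map F F' id) => e a b /sFF'; exact: conn_edge.
Qed.

Lemma joins_eq e u v a b :
  joins e u v -> joins e a b -> (a = u /\ b = v) \/ (a = v /\ b = u).
Proof.
rewrite /joins => /eqP-> /eqP E.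
have /set2P Ha : a \in [set u; v] by rewrite E set21.
have /set2P Hb : b \in [set u; v] by rewrite E set22.
have /set2P Hu : u \in [set a; b] by rewrite -E set21.
have /set2P Hv : v \in [set a; b] by rewrite -E set22.
intuition congruence.
Qed.

Lemma conn_setU1 F e u v a b : joins e u v -> conn (e |: F) a b ->
  [\/ conn F a b, conn F a u /\ conn F v b | conn F a v /\ conn F u b].
Proof.
move=> euv ab; apply: (conn_ind (P := fun b =>
  [\/ conn F a b, conn F a u /\ conn F v b | conn F a v /\ conn F u b]) _ ab);
  last by constructor 1; exact: conn_refl.
move=> f c d; rewrite !inE => /orP[/eqP-> ecd|fF fcd]; last first.
  have cd := conn_edge fF fcd.
  by case=> [ac|[au vc]|[av uc]];
    [constructor 1|constructor 2; split=> //|constructor 3; split=> //];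
    apply: conn_trans cd.
case: (joins_eq euv ecd) => -[-> ->] [].
- by constructor 2; rewrite conn_refl.
- by case=> au vu; constructor 2; rewrite conn_refl.
- by case=> av _; constructor 1.
- by constructor 3; rewrite conn_refl.
- by case=> au _; constructor 1.
- by case=> av uv; constructor 3; rewrite conn_refl.
Qed.

Lemma is_forest_sub F F' : F \subset F' -> is_forest F' -> is_forest F.
Proof. by move=> /subsetP s fF c cc sc; apply: (fF c cc) => f /sc /s. Qed.

Lemma is_forest0 : is_forest (set0 : {set edge G}).
Proof.
move=> [|[x e] c] [] // _ _ _ _ /(_ e).
by rewrite /= mem_head inE => /(_ isT).
Qed.

Let step (p q : vertex G * edge G) := joins p.2 p.1 q.1.

Lemma walk_conn F u f c w e : path step (u, f) (rcons c (w, e)) ->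
  {subset map snd ((u, f) :: c) <= F} -> conn F u w.
Proof.
elim: c u f => [|[v g] c IH] u f /= /andP[euv pp] s.
  by apply: conn_edge euv; apply: s; rewrite mem_head.
have fF : f \in F by apply: s; rewrite mem_head.
apply: (conn_trans (conn_edge fF euv)); apply: (IH v g pp) => h hc.
by apply: s; rewrite inE hc orbT.
Qed.

(** A new cycle must use [e]; rotated to start with [e], it leaves a walk in [F] between the two
    ends of [e]. *)
Lemma is_forest_setU1 F e u v : joins e u v -> ~~ conn F u v -> is_forest F ->
  is_forest (e |: F).
Proof.
move=> euv /negP nuv fF c [c0 cc uV uE] sc.
have [ec|nec] := boolP (e \in map snd c); last first.
  apply: (fF c) => // f fc; move: (sc f fc); rewrite !inE => /orP[/eqP fe|//].
  by rewrite -fe fc in nec.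
case/mapP: ec => -[w e'] wc /= ee'; subst e'.
case: (rot_to wc) => i c' Ec.
have cyc : cycle step ((w, e) :: c') by rewrite -Ec rot_cycle.
have uE' : uniq (e :: map snd c').
  by rewrite -[_ :: _]/(map snd ((w, e) :: c')) -Ec map_rot rot_uniq.
have sc' : {subset map snd c' <= F}.
  move=> f fc'; have: f \in map snd c.
    by rewrite -(mem_rot i) -map_rot Ec inE fc' orbT.
  move/sc; rewrite !inE => /orP[/eqP fe|//].
  by move: uE'; rewrite /= -fe fc'.
apply: nuv; case: c' cyc sc' {Ec uE'} => [|[t f] c'] /= /andP[ewt pp] sc'.
  by case: (joins_eq euv ewt) => -[-> ->]; rewrite conn_refl.
have tw : conn F t w by apply: walk_conn pp sc'.
by case: (joins_eq euv ewt) => -[<- <-] //; rewrite connC.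
Qed.

(* The edges of a simple path are distinct, because the edge leaving a vertex
   is not contained in the set of the later vertices. *)
Lemma simple_walk F u p : path (adj_in F) u p -> uniq (u :: p) ->
  exists c : seq (vertex G * edge G), [/\ map fst c = belast u p,
    {subset map snd c <= F}, uniq (map snd c),
    {in map snd c, forall f, ends f \subset (u :: p)} &
    forall e, sorted step (rcons c (last u p, e))].
Proof.
elim: p u => [|v p IH] u; first by exists [::]; split.
rewrite [path _ _ _]/= => /andP[/existsP[f /andP[fF fuv]] pp].
rewrite [uniq _]cons_uniq => /andP[nu un].
have [c [c1 c2 c3 c4 c5]] := IH v pp un; exists ((u, f) :: c); split.
- by rewrite /= c1.
- by move=> g /=; rewrite inE => /orP[/eqP-> //|/c2].
- rewrite /= c3 andbT; apply/negP => /c4 /subsetP/(_ u).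
  by rewrite (eqP fuv) set21 (negPf nu) => /(_ isT).
- move=> g /=; rewrite inE => /orP[/eqP->|/c4 /subsetP s]; apply/subsetP=> t.
    by rewrite (eqP fuv) !inE => /orP[]/eqP->; rewrite eqxx ?orbT.
  by move/s => tp; rewrite inE tp orbT.
move=> e; move: (c5 e); case: c c1 {c2 c3 c4 c5} => [|[t g] c] /=.
  case: p {IH pp nu un} => //= _ _; rewrite andbT; exact: fuv.
by case: p {IH pp nu un} => //= a p [-> _] ->; rewrite andbT; exact: fuv.
Qed.

(** A simple path in [F] between the ends of [e], closed up by [e], is a cycle; the empty path
    covers the case of a loop. *)
Lemma is_forest_nconn F e u v : e \notin F -> joins e u v ->
  is_forest (e |: F) -> ~~ conn F u v.
Proof.
move=> eF euv fF; apply/negP => /connectP[p0 pp0 Ev].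
case: (shortenP pp0) Ev => p pp un _ {p0 pp0} Ev.
have [c [c1 c2 c3 _ c5]] := simple_walk pp un.
apply: (fF ((v, e) :: c)); last first.
  by move=> f; rewrite /= !inE => /orP[->|/c2->] //; rewrite orbT.
split => //=; last first.
- by rewrite c3 andbT; apply: contra eF => /c2.
- by rewrite c1 Ev -rcons_uniq -lastI.
move: (c5 e); rewrite -Ev; case: c c1 {c2 c3 c5} => [|[t f] c] /= E.
  by case: p pp un Ev E => //= _ _ Ev _ _; move: euv; rewrite /step /= andbT -Ev.
move=> ->; rewrite andbT; case: p pp un Ev E => //= a p _ _ _ [-> _].
by rewrite /step /= joinsC.
Qed.
End Connectivity.

(** * Forests with separated roots, and deletion-contraction *)

Section ForestSums.
Variable G : graph.
Implicit Types (a b u v w x y z : vertex G) (e : edge G).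
Implicit Types (F H S : {set edge G}) (A : {set vertex G}).

Definition separated A F := [forall u in A, forall v in A, conn F u v ==> (u == v)].

Lemma separatedP A F :
  reflect {in A &, forall u v, conn F u v -> u = v} (separated A F).
Proof.
apply: (iffP forall_inP) => [h u v uA vA uv|h u uA].
  by apply/eqP; have /forall_inP/(_ v vA)/implyP := h u uA; apply.
by apply/forall_inP => v vA; apply/implyP => uv; apply/eqP; apply: h.
Qed.

Lemma separated1 x F : separated [set x] F.
Proof. by apply/separatedP => u v /set1P-> /set1P->. Qed.

Lemma separated_setU1 v A F :
  v \notin A -> separated (v |: A) F = separated A F && [forall u in A, ~~ conn F u v].
Proof.
move=> vA; apply/separatedP/andP => [h|[/separatedP h /forall_inP n] u w]; last first.
  move=> /setU1P[->|uA] /setU1P[->|wA] // uw; last exact: h.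
    by move: (n w wA); rewrite connC uw.
  by move: (n u uA); rewrite uw.
split; first by apply/separatedP => u w uA wA; apply: h; apply: setU1r.
apply/forall_inP => u uA; apply: contra vA => uv.
by rewrite -(h u v) ?setU11 ?setU1r.
Qed.

(** Adding [e] merges the trees of [r] and [v], so the roots stay apart exactly when the tree of [v]
    brings no other root. Contracting [e] thus amounts to making [v] a further root. *)
Lemma separated_add_edge A F e r v : joins e r v -> r \in A -> v \notin A ->
  separated (v |: A) F = ~~ conn F r v && separated A (e |: F).
Proof.
move=> erv rA vA; rewrite separated_setU1 //.
apply/andP/andP => -[].
  move=> /separatedP h /forall_inP n; split; first exact: n.
  apply/separatedP => u w uA wA /(conn_setU1 erv)[].
  - exact: h.
  - by case=> _; rewrite connC => vw; move: (n w wA); rewrite vw.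
  - by case=> uv; move: (n u uA); rewrite uv.
move=> nrv /separatedP h; split.
  by apply/separatedP => u w uA wA uw; apply: h => //; apply: conn_sub uw; apply: subsetUr.
apply/forall_inP => u uA; apply: contra nrv => uv.
rewrite (h r u) //; apply: (@conn_trans _ _ v).
  by apply: conn_edge erv; rewrite setU11.
by rewrite connC; apply: conn_sub uv; apply: subsetUr.
Qed.

Lemma ends_joins e : exists u v, joins e u v.
Proof.
have /andP[] := ends_card e; case: (posnP #|ends e|) => [->//|].
case/card_gt0P => u uE _ le2.
have [v vE|n] := pickP (mem (ends e :\ u)).
  move: vE; rewrite !inE => /andP[vu vE].
  exists u, v; rewrite /joins eq_sym eqEcard cards2 eq_sym vu le2 andbT.
  by apply/subsetP => t /set2P[]->.
exists u, u; rewrite /joins setUid eqEsubset sub1set uE andbT.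
by apply/subsetP => t tE; move: (n t); rewrite !inE tE andbT => /negbFE.
Qed.

(** Deleting an edge cuts a tree in two, and one of the halves contains no root; the end of the edge
    in that half serves as a new root, and induction on the edges applies. *)
Lemma card_separated A F : is_forest F -> separated A F ->
  (#|F| + #|A| <= #|vertex G|)%N.
Proof.
move En: #|F| => n; elim: n => [|n IH] in F A En *; first by rewrite max_card.
move=> fF; have [e eF] : exists e, e \in F by apply/card_gt0P; rewrite En.
pose F' := F :\ e; have EF : F = e |: F' by rewrite setD1K.
have nF' : #|F'| = n by apply/eqP; rewrite -eqSS -En (cardsD1 e F) eF.
have fF' : is_forest F' by apply: is_forest_sub fF; apply: subD1set.
have [u [w euw]] := ends_joins e.
have nuw : ~~ conn F' u w.
  by apply: (is_forest_nconn _ euw); rewrite -?EF // /F' setD11.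
move=> sA.
have sF' : separated A F'.
  apply/separatedP => a b aA bA ab; apply: (separatedP _ _ sA) => //.
  by apply: conn_sub ab; apply: subD1set.
suff [t tA st] : exists2 t, t \notin A & separated (t |: A) F'.
  by have := IH _ _ nF' fF' st; rewrite cardsU1 tA add1n addnS.
have extend t : (forall a, a \in A -> ~~ conn F' a t) ->
    exists2 t, t \notin A & separated (t |: A) F'.
  move=> n1; have tA : t \notin A by apply/negP => /n1; rewrite conn_refl.
  by exists t => //; rewrite separated_setU1 // sF'; apply/forall_inP.
have [/exists_inP[r rA ru]|] := boolP [exists a in A, conn F' a u]; last first.
  by rewrite negb_exists_in => /forall_inP; apply: extend.
apply: (extend w) => a aA; apply/negP => aw.
have ra : r = a.
  apply: (separatedP _ _ sA) => //; apply: (@conn_trans _ _ u).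
    by apply: conn_sub ru; apply: subD1set.
  apply: (@conn_trans _ _ w); first exact: conn_edge euw.
  by rewrite connC; apply: conn_sub aw; apply: subD1set.
by case/negP: nuw; apply: (conn_trans _ aw); rewrite -ra connC.
Qed.

Lemma in_forests F : (F \in forests G) = `[< is_forest F >].
Proof. by rewrite inE. Qed.

Section Weights.
Variable M : nmodType.
Implicit Type f : nat -> M.

(** The weight [f] is arbitrary so that powers of beta, monomials in ['X] and the indicator of a
    given size share one recursion. [S] is the set of edges forced to be present. *)
Definition forest_sum f A S H :=
  \sum_(F | [&& F \in forests G, S \subset F, F \subset H & separated A F]) f #|F|.

Lemma forest_sum_split f A S H e : e \notin S ->
  forest_sum f A S H = forest_sum f A S (H :\ e) + forest_sum f A (e |: S) H.
Proof.
move=> eS; rewrite /forest_sum (bigID (fun F => e \in F)) /= addrC.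
congr (_ + _); apply: eq_bigl => F.
  by rewrite subsetD1; case: (e \in F); rewrite ?(andbF, andbT) // -!andbA.
by rewrite subUset sub1set; case: (e \in F); rewrite ?(andbF, andbT).
Qed.

(** Removing [e] is a bijection, and [succn] restores the lost edge in the weight. The condition
    that [r] and [v] be unconnected, which keeps [e |: F] acyclic, is absorbed into the separation
    of [v |: A]. *)
Lemma forest_sum_edge f A S H e r v :
    e \in H -> e \notin S -> joins e r v -> r \in A -> v \notin A ->
  forest_sum f A (e |: S) H = forest_sum (f \o succn) (v |: A) S (H :\ e).
Proof.
move=> eH eS erv rA vA; rewrite /forest_sum.
rewrite (reindex_onto (fun F => e |: F) (fun F => F :\ e)); last first.
  by move=> F /and4P[_]; rewrite subUset sub1set => /andP[eF _] _ _; rewrite setD1K.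
rewrite [LHS](eq_bigr (fun F => f #|F|.+1)) => [|F /andP[_ /eqP E]]; last first.
  have eF : e \notin F by rewrite -E setD11.
  by rewrite cardsU1 eF.
apply: eq_bigl => F; have [eF|eF] := boolP (e \in F).
  rewrite subsetD1 eF !andbF; apply/negP => /andP[_ /eqP E].
  by move: eF; rewrite -E setD11.
rewrite setU1K // eqxx andbT subsetD1 eF andbT !subUset !sub1set setU11 eH /=.
rewrite (separated_add_edge _ erv rA vA) !in_forests.
have -> : (S \subset e |: F) = (S \subset F).
  apply/idP/idP => [/subsetP s|s]; last exact: subset_trans (subsetUr _ _).
  apply/subsetP => g gS; have /setU1P[ge|//] := s g gS.
  by rewrite -ge gS in eS.
have -> : `[< is_forest (e |: F) >] = `[< is_forest F >] && ~~ conn F r v.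
  apply/asboolP/andP => [h|[/asboolP h n]]; last exact: is_forest_setU1 erv n h.
  split; last exact: is_forest_nconn eF erv h.
  by apply/asboolP; apply: is_forest_sub h; apply: subsetUr.
by case: asbool => //=; case: (conn F r v); rewrite /= ?andbF ?andbT.
Qed.

Lemma forest_sum_rec f A H e r v : e \in H -> joins e r v -> r \in A -> v \notin A ->
  forest_sum f A set0 H =
  forest_sum f A set0 (H :\ e) + forest_sum (f \o succn) (v |: A) set0 (H :\ e).
Proof.
move=> eH erv rA vA; rewrite (forest_sum_split _ _ _ (e := e)) ?inE //.
by rewrite (forest_sum_edge _ _ _ erv) ?inE.
Qed.
End Weights.
End ForestSums.

(** * The matrix-tree theorem for rooted spanning forests *)

Section MatrixTree.
Variables (K : realFieldType) (G : graph).
Implicit Types (a b u v w x y z : vertex G) (e : edge G).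
Implicit Types (F H S : {set edge G}) (A : {set vertex G}).
Let n := #|vertex G|.

(** Parallel edges add up; loops only enter [mult H u u], which cancels on the diagonal of the
    Laplacian. *)
Definition mult H u v : K := \sum_(e in H) (joins e u v)%:R.

(* The rows of the Laplacian indexed by [A] are replaced by those of the identity,
   so the determinant is the principal minor obtained by deleting [A]. *)
Definition grounded_laplacian A H u v : K :=
  if u \in A then (u == v)%:R
  else (u == v)%:R * (\sum_w mult H u w) - mult H u v.

Definition grounded_mx A H : 'M[K]_n :=
  \matrix_(i, j) grounded_laplacian A H (enum_val i) (enum_val j).

(* [card_separated] makes [n - #|A|] the maximal size: these are the spanning
   forests each of whose trees contains exactly one vertex of [A]. *)
Definition rooted_forests A H : K :=
  forest_sum (fun k => (k == n - #|A|)%N%:R) A set0 H.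

Lemma mult_ge0 H u v : 0 <= mult H u v.
Proof. by apply: sumr_ge0 => e _; rewrite ler0n. Qed.

Lemma mult_gt0 H u v : (0 < mult H u v) = adj_in H u v.
Proof.
apply/idP/existsP => [|[e /andP[eH euv]]]; last first.
  rewrite /mult (bigD1 e) //= euv ltr_pwDl ?ltr01 //.
  by apply: sumr_ge0 => g _; rewrite ler0n.
apply: contraTP => /forallNP h; rewrite -leNgt /mult big1 // => e eH.
case euv: (joins e u v) => //; by case: (h e); rewrite eH.
Qed.

Lemma mult_setD1 H e u v : e \in H -> mult H u v = mult (H :\ e) u v + (joins e u v)%:R.
Proof.
move=> eH; rewrite /mult (big_setD1 e) //= addrC; congr (_ + _).
Qed.

Lemma grounded_laplacian_sum A H (g : vertex G -> K) u : u \notin A ->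
  \sum_v grounded_laplacian A H u v * g v = \sum_v mult H u v * (g u - g v).
Proof.
move=> /negPf uA; rewrite /grounded_laplacian uA.
under eq_bigr => v _ do rewrite mulrBl.
under [RHS]eq_bigr => v _ do rewrite mulrBr.
rewrite !sumrB; congr (_ - _).
rewrite (bigD1 u) //= eqxx mul1r [X in _ + X]big1 ?addr0 ?mulr_suml // => v vu.
by rewrite eq_sym (negPf vu) !mul0r.
Qed.

Lemma grounded_laplacian_root A H (g : vertex G -> K) u : u \in A ->
  \sum_v grounded_laplacian A H u v * g v = g u.
Proof.
move=> uA; rewrite /grounded_laplacian uA (bigD1 u) //= eqxx mul1r.
rewrite big1 ?addr0 // => v vu; by rewrite eq_sym (negPf vu) mul0r.
Qed.

Definition vec (g : vertex G -> K) : 'cV[K]_n := \col_i g (enum_val i).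

Lemma grounded_mxE A H g (i : 'I_n) j :
  (grounded_mx A H *m vec g) i j = \sum_v grounded_laplacian A H (enum_val i) v * g v.
Proof.
rewrite mxE [RHS](reindex (@enum_val _ (vertex G))) /=; last first.
  by apply: onW_bij; exact: enum_val_bij.
by apply: eq_bigr => k _; rewrite !mxE.
Qed.

Lemma row'_eq (B C : 'M[K]_n) i0 :
  (forall i j, i != i0 -> B i j = C i j) -> row' i0 B = row' i0 C.
Proof.
by move=> h; apply/matrixP => i j; rewrite !mxE h // eq_sym neq_lift.
Qed.

(* Adding [e] changes row [v] by [delta_v - delta_r], and row [r] is [delta_r]. *)
Lemma det_grounded_mx_rec A H e r v : e \in H -> joins e r v -> r \in A -> v \notin A ->
  \det (grounded_mx A H) =
  \det (grounded_mx A (H :\ e)) + \det (grounded_mx (v |: A) (H :\ e)).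
Proof.
move=> eH erv rA vA; pose iv := enum_rank v.
pose with_row (d : vertex G -> K) := \matrix_(i < n, j < n)
  if i == iv then d (enum_val j)
  else grounded_laplacian A (H :\ e) (enum_val i) (enum_val j).
have rv : r != v by apply: contraNneq vA => <-.
have nv (i : 'I_n) : i != iv -> enum_val i != v.
  by apply: contraNneq => E; rewrite /iv -E enum_valK.
have off_row k u : k != v ->
    grounded_laplacian A H k u = grounded_laplacian A (H :\ e) k u.
  move=> kv; rewrite /grounded_laplacian; case: ifP => // kA.
  have E w : mult H k w = mult (H :\ e) k w.
    rewrite (mult_setD1 _ _ eH); case J: (joins e k w); last by rewrite addr0.
    by case: (joins_eq erv J) => -[kE _]; move: kA kv; rewrite kE ?rA ?eqxx.
  by rewrite E; under eq_bigr => w _ do rewrite E.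
have on_row u : grounded_laplacian A H v u =
    grounded_laplacian A (H :\ e) v u + ((v == u)%:R - (r == u)%:R).
  have E w : mult H v w = mult (H :\ e) v w + (r == w)%:R.
    rewrite (mult_setD1 _ _ eH); congr (_ + _%:R); congr nat_of_bool.
    apply/idP/eqP => [J|<-]; last by rewrite joinsC.
    by case: (joins_eq erv J) => -[vE ->] //; rewrite vE eqxx in rv.
  rewrite /grounded_laplacian (negPf vA) E.
  under eq_bigr => w _ do rewrite E.
  have -> : \sum_w (mult (H :\ e) v w + (r == w)%:R) = \sum_w mult (H :\ e) v w + 1.
    rewrite big_split /=; congr (_ + _).
    rewrite (bigD1 r) //= eqxx big1 ?addr0 // => w.
    by rewrite eq_sym => /negPf->.
  by ring.
rewrite (@determinant_multilinear _ _ _ (grounded_mx A (H :\ e))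
  (with_row (fun u => (v == u)%:R - (r == u)%:R)) iv 1 1); first last.
- by apply: row'_eq => i j ii; rewrite !mxE (negPf ii) off_row // nv.
- by apply: row'_eq => i j ii; rewrite !mxE off_row // nv.
- by apply/rowP => j; rewrite !mxE eqxx enum_rankK on_row !mul1r.
rewrite !mul1r; congr (_ + _).
rewrite (@determinant_multilinear _ _ _ (with_row (fun u => (v == u)%:R))
  (with_row (fun u => (r == u)%:R)) iv 1 (-1)); first last.
- by apply: row'_eq => i j ii; rewrite !mxE (negPf ii).
- by apply: row'_eq => i j ii; rewrite !mxE (negPf ii).
- by apply/rowP => j; rewrite !mxE eqxx mul1r mulN1r.
(* With row [v] equal to [delta_r] there are two equal rows; with row [v] equal to [delta_v] the
   vertex [v] has become grounded. *)
rewrite [X in -1 * X](@determinant_alternate _ _ _ iv (enum_rank r)).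
- rewrite mulr0 addr0 mul1r; congr (\det _); apply/matrixP => i j; rewrite !mxE.
  rewrite /grounded_laplacian !inE; case: eqP => [->|/eqP ii].
    by rewrite enum_rankK eqxx.
  by rewrite (negPf (nv i ii)).
- by rewrite (inj_eq enum_rank_inj) eq_sym.
move=> j; rewrite !mxE eqxx (inj_eq enum_rank_inj) (negPf rv) enum_rankK.
by rewrite /grounded_laplacian rA.
Qed.

(** Since no edge leaves [A], the indicator of the complement of [A] is a nonzero kernel vector. *)
Lemma det_grounded_mx_closed A H : A != setT ->
    (forall e r v, e \in H -> joins e r v -> r \in A -> v \in A) ->
  \det (grounded_mx A H) = 0.
Proof.
move=> AT cA; rewrite -det_tr; apply/eqP/det0P.
pose g v : K := (v \notin A)%:R.
exists (vec g)^T.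
  have [v vA] : exists v, v \notin A.
    by apply/existsP; apply: contraR AT; rewrite negb_exists => /forallP h;
       apply/eqP/setP => v; rewrite !inE; move: (h v); rewrite negbK.
  apply/eqP => /matrixP/(_ 0 (enum_rank v)); rewrite !mxE enum_rankK /g vA.
  by move/eqP; rewrite oner_eq0.
rewrite -trmx_mul; apply/matrixP => i j; rewrite mxE grounded_mxE [RHS]mxE.
have [uA|uA] := boolP (enum_val j \in A).
  by rewrite grounded_laplacian_root // /g uA.
rewrite grounded_laplacian_sum // big1 // => v _; rewrite /g uA.
have [vA|vA] := boolP (v \in A); last by rewrite subrr mulr0.
rewrite /mult big1 ?mul0r // => e eH; case J: (joins e _ _) => //.
by move: uA; rewrite (cA e v) // joinsC.
Qed.

(** The trees of the roots stay inside [A], so a vertex outside can be added as a root, and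
    [card_separated] then leaves fewer than [n - #|A|] edges. *)
Lemma rooted_forests_closed A H : A != setT ->
    (forall e r v, e \in H -> joins e r v -> r \in A -> v \in A) ->
  rooted_forests A H = 0.
Proof.
move=> AT cA; rewrite /rooted_forests /forest_sum big1 // => F.
rewrite in_forests => /and4P[/asboolP fF _ sFH sA].
have [v vA] : exists v, v \notin A.
  by apply/existsP; apply: contraR AT; rewrite negb_exists => /forallP h;
     apply/eqP/setP => v; rewrite !inE; move: (h v); rewrite negbK.
have sv : separated (v |: A) F.
  rewrite separated_setU1 // sA; apply/forall_inP => r rA; apply: contra vA => rv.
  apply: (conn_ind (P := fun w => w \in A) _ rv) => // e a b eF; apply: cA.
  exact: (subsetP sFH).
have := card_separated fF sv; rewrite cardsU1 vA add1n addnS => lt.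
by case: eqP => // E; move: lt; rewrite E subnK ?max_card // ltnn.
Qed.

(** Both sides obey the same deletion-contraction along an edge leaving [A]. If there is none, both
    vanish, unless [A] is everything and both equal 1. *)
Lemma matrix_tree A H : \det (grounded_mx A H) = rooted_forests A H.
Proof.
move En: #|H| => m; elim/ltn_ind: m => m IH in A H En *.
have [[e [r [v [eH erv rA vA]]]]|nex] :=
  pselect (exists e r v, [/\ e \in H, joins e r v, r \in A & v \notin A]).
  have lt : (#|H :\ e| < m)%N by rewrite -En (cardsD1 e H) eH.
  rewrite (det_grounded_mx_rec eH erv rA vA) !(IH _ lt) // /rooted_forests.
  rewrite [RHS](forest_sum_rec _ eH erv rA vA); congr (_ + _).
  (* The two size conditions agree because [#|A| < n], so that the truncated subtraction is
     exact. *)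
  apply: eq_bigr => F _ /=; rewrite cardsU1 vA.
  have : (#|v |: A| <= n)%N by exact: max_card.
  rewrite cardsU1 vA add1n => lA.
  by rewrite -[in RHS](subnSK lA) eqSS.
have cA e r v : e \in H -> joins e r v -> r \in A -> v \in A.
  by move=> eH erv rA; apply/negPn/negP => vA; apply: nex; exists e, r, v.
have [AT|AT] := eqVneq A setT; last first.
  by rewrite det_grounded_mx_closed // rooted_forests_closed.
have -> : grounded_mx A H = 1%:M.
  apply/matrixP => i j; rewrite !mxE /grounded_laplacian AT inE.
  by rewrite (inj_eq enum_val_inj).
rewrite det1 /rooted_forests /forest_sum (bigD1 set0) /=; last first.
  rewrite in_forests !sub0set /=; apply/andP; split.
    by apply/asboolP; exact: is_forest0.
  apply/separatedP => u v _ _ uv; apply: (conn_ind (P := fun w => u = w) _ uv) => //.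
  by move=> e a b; rewrite inE.
rewrite AT cardsT cards0 /n subnn eqxx big1 ?addr0 // => F.
rewrite -cards_eq0 => /andP[_ /negPf ->] //.
Qed.
End MatrixTree.

(** * Minimum principles, Green functions and strict monotonicity in the grounded set *)

Section MaximumPrinciple.
Variables (K : realFieldType) (G : graph).
Implicit Types (a b u v w x y z : vertex G) (e : edge G).
Implicit Types (F H S : {set edge G}) (A : {set vertex G}) (g : vertex G -> K).

Definition laplacian_at A H g u := \sum_v grounded_laplacian K A H u v * g v.

Lemma laplacian_atB A H g g' u : laplacian_at A H (fun v => g v - g' v) u =
  laplacian_at A H g u - laplacian_at A H g' u.
Proof. by rewrite -sumrB; apply: eq_bigr => v _; rewrite mulrBr. Qed.

(** At a minimum every term [mult K H a v * (g a - g v)] is nonpositive; as their sum is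
    nonnegative, all of them vanish. *)
Lemma minimum_step A H g a : a \notin A -> 0 <= laplacian_at A H g a ->
  (forall v, g a <= g v) ->
  laplacian_at A H g a = 0 /\ forall b, adj_in H a b -> g b = g a.
Proof.
move=> aA; rewrite /laplacian_at grounded_laplacian_sum // => S0 mina.
have le0 v : mult K H a v * (g a - g v) <= 0.
  by rewrite mulr_ge0_le0 ?mult_ge0 // subr_le0.
have /eqP S1 : \sum_v mult K H a v * (g a - g v) == 0.
  by rewrite eq_le S0 andbT sumr_le0.
split=> // b ab; apply/eqP; rewrite eq_le mina andbT -subr_le0 -oppr_ge0 opprB.
have m0 : 0 < mult K H a b by rewrite mult_gt0.
rewrite -(pmulr_rge0 _ m0) -S1 (bigD1 b) //= gerDl.
by apply: sumr_le0 => v _.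
Qed.

Section Grounded.
Variables (A : {set vertex G}) (H : {set edge G}).
Hypothesis grounded : forall u, exists2 r, r \in A & conn H u r.

(** A negative minimum would propagate along edges to a root, where [laplacian_at] is the value of
    [g] itself. *)
Lemma minimum_principle g : (forall u, 0 <= laplacian_at A H g u) ->
  forall u, 0 <= g u.
Proof.
move=> Lg u0; case: (arg_minP g (i0 := u0) (P := xpredT)) => // u _ minu.
apply: (le_trans _ (minu u0 isT)); rewrite leNgt; apply/negP => gu.
have notA w : g w = g u -> w \notin A.
  move=> gw; apply/negP => wA; have := Lg w.
  by rewrite /laplacian_at grounded_laplacian_root // gw leNgt gu.
have [r rA ur] := grounded u.
suff /notA : g r = g u by rewrite rA.
apply: (conn_ind (P := fun w => g w = g u) _ ur) => // e a b eH eab ga.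
have [|_ ->//] := @minimum_step A H g a (notA a ga) (Lg a).
  by move=> v; rewrite ga minu.
by apply/existsP; exists e; rewrite eH.
Qed.

(** The minimum principle applies to a kernel vector and to its opposite, so the vector is zero. *)
Lemma det_grounded_mx_neq0 : \det (grounded_mx K A H) != 0.
Proof.
rewrite -det_tr; apply/negP => /det0P[r r0 rM].
pose g w := r 0 (enum_rank w).
have Eg : vec g = r^T by apply/colP => i; rewrite !mxE /g enum_valK.
have Lg u : laplacian_at A H g u = 0.
  rewrite /laplacian_at -(enum_rankK u) -(grounded_mxE A H g _ 0) Eg.
  by rewrite -[grounded_mx _ _ _]trmxK -trmx_mul rM !mxE.
have g0 u : 0 <= g u by apply: minimum_principle => w; rewrite Lg.
have g0' u : 0 <= 0 - g u.
  apply: (minimum_principle (g := fun u => 0 - g u)) => w.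
  rewrite (laplacian_atB _ _ (fun=> 0)) Lg subr0 /laplacian_at big1 // => v _.
  by rewrite mulr0.
case/negP: r0; apply/eqP/rowP => i; rewrite mxE.
move: (g0 (enum_val i)) (g0' (enum_val i)); rewrite sub0r oppr_ge0 /g enum_valK => h1 h2.
by apply/eqP; rewrite eq_le h1 h2.
Qed.

Lemma rooted_forests_gt0 : 0 < rooted_forests K A H.
Proof.
rewrite lt_neqAle eq_sym -matrix_tree det_grounded_mx_neq0 matrix_tree.
by apply: sumr_ge0 => F _; rewrite ler0n.
Qed.

Lemma green_function z : exists g, forall u, laplacian_at A H g u = (u == z)%:R.
Proof.
pose d : 'cV[K]_#|vertex G| := \col_i (enum_val i == z)%:R.
pose c := invmx (grounded_mx K A H) *m d.
pose g w := c (enum_rank w) 0.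
have Eg : vec g = c by apply/colP => i; rewrite !mxE /g enum_valK mxE.
exists g => u; rewrite /laplacian_at -(enum_rankK u) -(grounded_mxE A H g _ 0) Eg.
by rewrite mulKVmx ?mxE // unitmxE unitfE det_grounded_mx_neq0.
Qed.
End Grounded.

(* Cramer's rule for the [z]-entry of the solution of a linear system with
   right-hand side [delta_z]. *)
Lemma rooted_forests_green A H g z : z \notin A ->
    (forall u, laplacian_at A H g u = (u == z)%:R) ->
  rooted_forests K (z |: A) H = rooted_forests K A H * g z.
Proof.
move=> zA Lg; rewrite -!matrix_tree; pose iz := enum_rank z.
(* Grounding [z] turns its row into [delta_z]; expanding along that row leaves a single cofactor,
   which does not see the row. *)
have -> : \det (grounded_mx K (z |: A) H) = \adj (grounded_mx K A H) iz iz.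
  rewrite (expand_det_row _ iz) (bigD1 iz) //= big1 => [|i iiz].
    rewrite !mxE /grounded_laplacian !inE enum_rankK eqxx mul1r addr0.
    rewrite /cofactor; congr (_ * \det _); apply/matrixP => i j; rewrite !mxE.
    rewrite /grounded_laplacian !inE -(inj_eq enum_rank_inj) enum_valK.
    by rewrite eq_sym (negPf (neq_lift _ _)).
  rewrite !mxE /grounded_laplacian !inE enum_rankK eqxx /=.
  by rewrite -(inj_eq enum_rank_inj) enum_valK eq_sym (negPf iiz) mul0r.
have Mg : grounded_mx K A H *m vec g = \col_i (i == iz)%:R.
  apply/colP => i; rewrite grounded_mxE mxE -/(laplacian_at A H g _) Lg.
  by rewrite -(inj_eq enum_rank_inj) enum_valK.
have /matrixP/(_ iz 0) : \adj (grounded_mx K A H) *m (grounded_mx K A H *m vec g) =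
    \det (grounded_mx K A H) *: vec g by rewrite mulmxA mul_adj_mx mul_scalar_mx.
rewrite Mg mxE (bigD1 iz) //= big1 => [|i iiz]; last first.
  by rewrite [(\col__ _) _ _]mxE (negPf iiz) mulr0.
by rewrite !mxE eqxx mulr1 addr0 enum_rankK.
Qed.

(** Deletes the vertex [x] without changing the vertex type: [x] becomes isolated. *)
Definition avoiding H x := [set e in H | x \notin ends e].

(** A zero of a nonnegative function is a minimum. Away from [x] it is never a root, so
    [minimum_step] passes it on to its neighbours. *)
Lemma zero_spread A H x g a b : (forall u, 0 <= g u) ->
    (forall u, 0 <= laplacian_at A H g u) -> {in A, forall u, u != x -> 0 < g u} ->
  conn (avoiding H x) a b -> a != x -> g a = 0 -> b != x /\ g b = 0.
Proof.
move=> g0 Lg gA ab ax ga.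
apply: (conn_ind (P := fun b => b != x /\ g b = 0) _ ab) => // e c d.
rewrite !inE => /andP[eH xe] ecd [cx gc].
have cA : c \notin A by apply/negP => /gA/(_ cx); rewrite gc ltxx.
have [|_ /(_ d) ->] := minimum_step cA (Lg c); first by move=> v; rewrite gc.
  by split=> //; apply: contraNneq xe => <-; rewrite (eqP ecd) set22.
by apply/existsP; exists e; rewrite eH.
Qed.

(* The difference of the two sides is a positive multiple of [g z - g' z] for the
   Green functions [g], [g'] grounded at [x] and at [x], [y]: grounding one more
   vertex strictly decreases the potential. *)
Lemma rooted_forests_lt H x y z : x != y -> x != z -> y != z ->
    (forall u, conn H u x) -> conn (avoiding H x) y z ->
  rooted_forests K (z |: (y |: [set x])) H * rooted_forests K [set x] H <
  rooted_forests K (y |: [set x]) H * rooted_forests K (z |: [set x]) H.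
Proof.
move=> xy xz yz cx cyz.
have gr A : x \in A -> forall u, exists2 r, r \in A & conn H u r.
  by move=> xA u; exists x.
have grx := gr [set x] (set11 x); have gry := gr (y |: [set x]) (setU1r _ (set11 x)).
have [g Lg] := green_function grx z; have [g' Lg'] := green_function gry z.
rewrite (rooted_forests_green _ Lg') ?(rooted_forests_green _ Lg) ?inE; last first.
- by rewrite negb_or eq_sym yz eq_sym.
- by rewrite eq_sym.
rewrite mulrAC mulrA ltr_pM2l ?mulr_gt0 ?rooted_forests_gt0 //.
have g0 u : 0 <= g u by apply: (minimum_principle grx) => w; rewrite Lg ler0n.
(* A zero at [w] would spread to [z], where [minimum_step] forces the Laplacian to be 0 although it
   is 1. *)
have pos w : w != x -> conn (avoiding H x) w z -> 0 < g w.
  move=> wx wz; rewrite lt_neqAle g0 andbT eq_sym; apply/eqP => gw.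
  have [||_ gz] := @zero_spread [set x] H x g w z g0 _ _ wz wx gw.
  - by move=> u; rewrite Lg ler0n.
  - by move=> u /set1P->; rewrite eqxx.
  have [|||/eqP + _] := @minimum_step [set x] H g z.
  - by rewrite inE eq_sym.
  - by rewrite Lg ler0n.
  - by move=> v; rewrite gz.
  by rewrite Lg eqxx oner_eq0.
have gy : 0 < g y by apply: pos; rewrite // eq_sym.
have Lx : g x = 0.
  by have := Lg x; rewrite /laplacian_at grounded_laplacian_root ?inE // (negPf xz).
have rootg' r : r \in y |: [set x] -> g' r = 0.
  move=> rA; have := Lg' r; rewrite /laplacian_at grounded_laplacian_root // => ->.
  by move: rA; rewrite !inE => /orP[]/eqP->; rewrite ?(negPf xz) ?(negPf yz).
(* The poles at [z] cancel, so [h] is harmonic off the roots, with value 0 at [x] and [g y > 0] at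
   [y]. A zero at [z] would spread back to [y]. *)
pose h v := g v - g' v.
have hE r : r \in y |: [set x] -> h r = g r by move=> rA; rewrite /h rootg' ?subr0.
have Lh u : 0 <= laplacian_at (y |: [set x]) H h u.
  have [uA|uA] := boolP (u \in y |: [set x]).
    by rewrite /laplacian_at grounded_laplacian_root // hE.
  rewrite laplacian_atB Lg' /laplacian_at !grounded_laplacian_sum //.
  rewrite -(grounded_laplacian_sum (A := [set x])) ?Lg ?subrr //.
    by rewrite -/(laplacian_at _ _ _ _) Lg subrr.
  by move: uA; rewrite !inE negb_or => /andP[].
have h0 := minimum_principle gry Lh.
rewrite -subr_gt0 -/(h z) lt_neqAle h0 andbT eq_sym; apply/eqP => hz.
have [|||_ hy] := @zero_spread (y |: [set x]) H x h z y h0 Lh _ _ _ hz.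
- by move=> u uA; rewrite hE //; move: uA; rewrite !inE => /orP[]/eqP->; rewrite ?eqxx.
- by rewrite connC.
- by rewrite eq_sym.
by move: gy; rewrite -hE ?setU11 // hy ltxx.
Qed.
End MaximumPrinciple.

(** * Comparison of leading coefficients in beta *)

Section LeadingCoefficient.
Variables (K : realFieldType) (G : graph).
Implicit Types (x y z : vertex G) (H S : {set edge G}) (A : {set vertex G}).

Definition forest_mass (beta : K) A S H := forest_sum (fun k => beta ^+ k) A S H.

Definition forest_poly A H : {poly K} := forest_sum (fun k => 'X^k) A set0 H.

Lemma horner_forest_poly beta A H :
  (forest_poly A H).[beta] = forest_mass beta A set0 H.
Proof. by rewrite horner_sum; apply: eq_bigr => F _; rewrite hornerXn. Qed.

Lemma size_forest_poly A H : (size (forest_poly A H) <= (#|vertex G| - #|A|).+1)%N.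
Proof.
apply: (leq_trans (size_sum _ _ _)); apply/bigmax_leqP => F.
rewrite in_forests => /and4P[/asboolP fF _ _ sA].
by rewrite size_polyXn ltnS leq_subRL ?max_card // addnC card_separated.
Qed.

Lemma coef_forest_poly A H :
  (forest_poly A H)`_(#|vertex G| - #|A|) = rooted_forests K A H.
Proof.
rewrite coef_sum; apply: eq_bigr => F _.
by rewrite coefXn eq_sym.
Qed.

(** In the convolution, an index below [a] reads [q] beyond degree [b], and an index above [a] reads
    [p] beyond degree [a]. *)
Lemma coefM_top (p q : {poly K}) a b : (size p <= a.+1)%N -> (size q <= b.+1)%N ->
  (p * q)`_(a + b) = p`_a * q`_b.
Proof.
move=> sp sq; have aab : (a < (a + b).+1)%N by rewrite ltnS leq_addr.
rewrite coefM (bigD1 (Ordinal aab)) //= addKn big1 ?addr0 // => i ia.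
have [lt|gt|E] := ltngtP (i : nat) a; last by case/eqP: ia; apply: val_inj.
  rewrite (nth_default 0 (s := q)) ?mulr0 //; apply: leq_trans sq _.
  by rewrite -addnBAC ?(ltnW lt) // -[b.+1]addn1 addnC leq_add2r subn_gt0.
by rewrite (nth_default 0 (s := p)) ?mul0r //; apply: leq_trans sp _.
Qed.

Lemma forest_mass_eventually H x y z : x != y -> x != z -> y != z ->
    (forall u, conn H u x) -> conn (avoiding H x) y z ->
  exists b : K, forall beta, b <= beta ->
    forest_mass beta (z |: (y |: [set x])) set0 H * forest_mass beta [set x] set0 H <=
    forest_mass beta (y |: [set x]) set0 H * forest_mass beta (z |: [set x]) set0 H.
Proof.
move=> xy xz yz cx cyz.
have c1 := cards1 x.
have c2 : #|y |: [set x]| = 2%N by rewrite cardsU1 c1 inE eq_sym xy.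
have c2' : #|z |: [set x]| = 2%N by rewrite cardsU1 c1 inE eq_sym xz.
have c3 : #|z |: (y |: [set x])| = 3%N.
  by rewrite cardsU1 c2 !inE negb_or eq_sym yz eq_sym xz.
have n3 : (2 < #|vertex G|)%N by rewrite -c3 max_card.
have s A : (size (forest_poly A H) <= (#|vertex G| - #|A|).+1)%N.
  exact: size_forest_poly.
have [s1 s2] := (s [set x], s (y |: [set x])); rewrite c1 c2 in s1 s2.
have [s2' s3] := (s (z |: [set x]), s (z |: (y |: [set x]))).
rewrite c2' c3 in s2' s3.
have co A := coef_forest_poly A H.
have [co1 co2] := (co [set x], co (y |: [set x])); rewrite c1 c2 in co1 co2.
have [co2' co3] := (co (z |: [set x]), co (z |: (y |: [set x]))).
rewrite c2' c3 in co2' co3.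
(* Both products have the same degree bound 2n - 4; the truncated subtractions are exact because n
   is at least 3. *)
have n22 : (#|vertex G| - 2 + (#|vertex G| - 2))%N =
           (#|vertex G| - 3 + (#|vertex G| - 1))%N.
  by case: #|vertex G| n3 => [|[|[|m]]] // _; rewrite !subSS !subn0 addSnnS.
pose Q := forest_poly (y |: [set x]) H * forest_poly (z |: [set x]) H
  - forest_poly (z |: (y |: [set x])) H * forest_poly [set x] H.
pose d := (#|vertex G| - 2 + (#|vertex G| - 2))%N.
have Qd : 0 < Q`_d.
  rewrite coefB {1}/d (coefM_top s2 s2') /d n22 (coefM_top s3 s1).
  by rewrite co1 co2 co2' co3 subr_gt0 rooted_forests_lt.
have sM (p q : {poly K}) a b : (size p <= a.+1)%N -> (size q <= b.+1)%N ->
    (size (p * q)%R <= (a + b).+1)%N.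
  move=> sp sq; apply: leq_trans (size_polyMleq _ _) _.
  by have := leq_add sp sq; rewrite addSn addnS; case: (_ + _)%N.
have sQ : (size Q <= d.+1)%N.
  apply: (leq_trans (size_polyD _ _)); rewrite size_polyN geq_max.
  by rewrite (sM _ _ _ _ s2 s2') /d n22 (sM _ _ _ _ s3 s1).
have lQ : 0 < lead_coef Q.
  suff -> : lead_coef Q = Q`_d by [].
  rewrite lead_coefE; congr (Q`_ _); apply/eqP; rewrite eqn_leq.
  have lt : (d < size Q)%N.
    by rewrite ltnNge; apply/negP => /(nth_default 0) E; rewrite E ltxx in Qd.
  by rewrite -ltnS (ltn_predK lt) -[(d <= _)%N]ltnS (ltn_predK lt) sQ lt.
have [b hb] := poly_pinfty_gt_lc lQ; exists b => beta /hb le.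
rewrite -subr_ge0; move: (ltW (lt_le_trans lQ le)).
by rewrite /Q hornerD hornerN !hornerM !horner_forest_poly.
Qed.
End LeadingCoefficient.

(** * Factorization of forest sums at a cut vertex *)

Section CutVertex.
Variables (K : realFieldType) (G : graph).
Variables (H : {set edge G}) (x y z : vertex G).
Hypotheses (xy : x != y) (xz : x != z).
Hypothesis sepyz : ~~ conn (avoiding H x) y z.
Implicit Types (a b u v w : vertex G) (e : edge G) (F S : {set edge G}).

(** [C] is the component of [y] after deleting [x]. Edges of [H1] have their ends in [C] or at [x],
    those of [H2] outside [C], so the two sides can meet only at [x]. *)
Let C := [set u | conn (avoiding H x) y u].
Let H1 := [set e in H | ends e :&: C != set0].
Let H2 := H :\: H1.

Lemma sideC_avoids : x \notin C.
Proof.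
rewrite inE; apply/negP => yx.
suff : x != x by rewrite eqxx.
apply: (conn_ind (P := fun w => x != w) _ yx) => // e a b.
rewrite inE => /andP[_ xe] eab _; apply: contraNneq xe => ->.
by rewrite (eqP eab) set22.
Qed.

Lemma side1_end e a b : e \in H -> joins e a b -> a \in C -> (b \in C) || (b == x).
Proof.
move=> eH eab aC; case: eqP => [_|/eqP bx]; first by rewrite orbT.
rewrite orbF inE; apply: (conn_trans (y := a)); first by rewrite inE in aC.
apply: (conn_edge _ eab); rewrite inE eH (eqP eab) !inE negb_or.
by rewrite eq_sym in bx; rewrite bx andbT; apply: contraNneq sideC_avoids => ->.
Qed.

Lemma side1_ends e a b : e \in H1 -> joins e a b -> (a \in C) || (a == x).
Proof.
rewrite inE => /andP[eH /set0Pn[c]] /[swap] eab.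
rewrite (eqP eab) inE => /andP[/set2P[]-> cC]; first by rewrite cC.
by apply: (side1_end eH _ cC); rewrite joinsC.
Qed.

Lemma side2_ends e a b : e \in H2 -> joins e a b -> a \notin C.
Proof.
rewrite in_setD => /andP[+ eH] eab; apply: contraNN => aC.
by rewrite inE eH; apply/set0Pn; exists a; rewrite in_setI aC (eqP eab) set21.
Qed.

(* Contracting either side of the cut vertex [x] onto [x] maps walks to walks. *)
Let fold1 v := if v \in C then v else x.
Let fold2 v := if v \in C then x else v.

Lemma conn_fold1 F u v : F \subset H -> conn F u v ->
  conn (F :&: H1) (fold1 u) (fold1 v).
Proof.
move=> /subsetP sFH; apply: conn_map => e a b eF eab.
have [e1|e1] := boolP (e \in H1); last first.
  have e2 : e \in H2 by rewrite in_setD e1 sFH.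
  rewrite /fold1 (negPf (side2_ends e2 eab)).
  by rewrite joinsC in eab; rewrite (negPf (side2_ends e2 eab)) conn_refl.
have fixed c d : joins e c d -> fold1 c = c.
  by move/(side1_ends e1); rewrite /fold1; case: ifP => //= _ /eqP.
rewrite (fixed a b) // (fixed b a) 1?joinsC //.
by apply: conn_edge eab; rewrite in_setI eF.
Qed.

Lemma conn_fold2 F u v : F \subset H -> conn F u v ->
  conn (F :&: H2) (fold2 u) (fold2 v).
Proof.
move=> /subsetP sFH; apply: conn_map => e a b eF eab.
have [e1|e1] := boolP (e \in H1); last first.
  have e2 : e \in H2 by rewrite in_setD e1 sFH.
  have fixed c d : joins e c d -> fold2 c = c.
    by move/(side2_ends e2); rewrite /fold2 => /negPf->.
  rewrite (fixed a b) // (fixed b a) 1?joinsC //.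
  by apply: conn_edge eab; rewrite in_setI eF.
have fixed c d : joins e c d -> fold2 c = x.
  by move/(side1_ends e1); rewrite /fold2; case: ifP => //= _ /eqP.
by rewrite (fixed a b) // (fixed b a) 1?joinsC // conn_refl.
Qed.

(** Edges are added one at a time: if the ends of the new edge were already connected, folding onto
    its side would connect them within that side, against acyclicity there. *)
Lemma is_forest_glue F : F \subset H ->
  is_forest (F :&: H1) -> is_forest (F :&: H2) -> is_forest F.
Proof.
move En: #|F| => m; elim: m => [|m IH] in F En *.
  by move=> _ _ _; move/eqP: En; rewrite cards_eq0 => /eqP->; apply: is_forest0.
move=> sFH f1 f2; have [e eF] : exists e, e \in F by apply/card_gt0P; rewrite En.
pose F' := F :\ e; have EF : F = e |: F' by rewrite setD1K.
have eF' : e \notin F' by rewrite setD11.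
have sF'H : F' \subset H by apply: subset_trans sFH; apply: subD1set.
have nF' : #|F'| = m by apply/eqP; rewrite -eqSS -En (cardsD1 e F) eF.
have fF' : is_forest F'.
  by apply: IH => //; [apply: is_forest_sub f1|apply: is_forest_sub f2];
    apply: setSI; apply: subD1set.
have [u [w euw]] := ends_joins e.
have ewu : joins e w u by rewrite joinsC.
rewrite EF; apply: (is_forest_setU1 euw _ fF').
have [e1|e1] := boolP (e \in H1).
  have fixed c d : joins e c d -> fold1 c = c.
    by move/(side1_ends e1); rewrite /fold1; case: ifP => //= _ /eqP.
  have : ~~ conn (F' :&: H1) u w.
    apply: (is_forest_nconn (e := e) _ euw); first by rewrite in_setI negb_and eF'.
    by rewrite -(setIidPl (_ : [set e] \subset H1)) ?sub1set // -setIUl -EF.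
  by apply: contra => /(conn_fold1 sF'H); rewrite (fixed u w) // (fixed w u).
have e2 : e \in H2 by rewrite in_setD e1 (subsetP sFH).
have fixed c d : joins e c d -> fold2 c = c.
  by move/(side2_ends e2); rewrite /fold2 => /negPf->.
have : ~~ conn (F' :&: H2) u w.
  apply: (is_forest_nconn (e := e) _ euw); first by rewrite in_setI negb_and eF'.
  by rewrite -(setIidPl (_ : [set e] \subset H2)) ?sub1set // -setIUl -EF.
by apply: contra => /(conn_fold2 sF'H); rewrite (fixed u w) // (fixed w u).
Qed.

Let yC : y \in C. Proof. by rewrite inE conn_refl. Qed.
Let zC : z \notin C. Proof. by rewrite inE. Qed.
Let xC := sideC_avoids.

Lemma conn_side1 F : F \subset H -> conn F x y = conn (F :&: H1) x y.
Proof.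
move=> sFH; apply/idP/idP => [/(conn_fold1 sFH)|].
  by rewrite /fold1 yC (negPf xC).
by apply: conn_sub; apply: subsetIl.
Qed.

Lemma conn_side2 F : F \subset H -> conn F x z = conn (F :&: H2) x z.
Proof.
move=> sFH; apply/idP/idP => [/(conn_fold2 sFH)|].
  by rewrite /fold2 (negPf zC) (negPf xC).
by apply: conn_sub; apply: subsetIl.
Qed.

Lemma separated_pair F a b : a != b -> separated (b |: [set a]) F = ~~ conn F a b.
Proof.
move=> ab; rewrite separated_setU1 ?inE 1?eq_sym // separated1 /=.
apply/forall_inP/idP => [->//|n u /set1P->//]; by rewrite inE.
Qed.

Lemma separated_cut F : y != z -> F \subset H ->
  separated (z |: (y |: [set x])) F =
  ~~ conn (F :&: H1) x y && ~~ conn (F :&: H2) x z.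
Proof.
move=> yz sFH; rewrite separated_setU1 ?inE ?negb_or 1?eq_sym ?yz 1?eq_sym //.
rewrite separated_pair // -conn_side1 // -conn_side2 //.
have [xyF|xyF] //= := boolP (conn F x y).
apply/forall_inP/idP => [->//|n u]; first by rewrite !inE eqxx orbT.
(* A connection between [y] and [z] folds to one between [y] and [x], so it is already excluded. *)
rewrite !inE => /orP[]/eqP-> //; apply: contra xyF => /(conn_fold1 sFH).
by rewrite /fold1 yC (negPf zC) connC -conn_side1.
Qed.

Variable beta : K.

Let mass (p : pred {set edge G}) S :=
  \sum_(F | [&& F \in forests G, F \subset S & p F]) beta ^+ #|F|.

(** A forest corresponds to the pair of its traces on [H1] and [H2]: sizes add up, and by
    [is_forest_glue] any two forests on the sides can be combined. *)
Lemma mass_cut p1 p2 :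
  mass (fun F => p1 (F :&: H1) && p2 (F :&: H2)) H = mass p1 H1 * mass p2 H2.
Proof.
have sH1 : H1 \subset H by apply/subsetP => e; rewrite inE => /andP[].
have H12 : H1 :|: H2 = H by rewrite /H2 -{1}(setIidPr sH1) setID.
have H1I2 : H1 :&: H2 = set0.
  by apply/setP => e; rewrite in_setI in_setD in_set0; case: (e \in H1).
rewrite /mass big_distrlr /= pair_big /=.
rewrite [RHS](reindex_onto (fun F => (F :&: H1, F :&: H2)) (fun q => q.1 :|: q.2)).
  apply: eq_big => [F|F /and3P[_ sFH _]] /=; last first.
    by rewrite -exprD -cardsUI -setIUr H12 setIACA H1I2 setI0 cards0 addn0 (setIidPl sFH).
  rewrite !subsetIr -setIUr H12 (sameP setIidPl eqP) !in_forests andbC.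
  case: eqP => [sFH|_] /=; last by rewrite !andbF.
  have -> : `[< is_forest F >] = `[< is_forest (F :&: H1) >] && `[< is_forest (F :&: H2) >].
    apply/asboolP/andP => [f|[/asboolP f1 /asboolP f2]].
      by split; apply/asboolP; apply: is_forest_sub f; apply: subsetIl.
    by apply: is_forest_glue => //; apply/setIidPl.
  by rewrite andbT andbC andbACA.
move=> [F1 F2] /= /andP[/and3P[_ /setIidPl s1 _] /and3P[_ /setIidPl s2 _]].
rewrite !setIUl.
have -> : F1 :&: H2 = set0 by rewrite -s1 -setIA H1I2 setI0.
have -> : F2 :&: H1 = set0 by rewrite -s2 -setIA [H2 :&: _]setIC H1I2 setI0.
by rewrite s1 s2 setU0 set0U.
Qed.

(** Each of the four sums is a product of a factor for [H1] and one for [H2], and both sides of the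
    identity collect the same four factors. *)
Lemma forest_mass_cut : y != z ->
  forest_mass beta (z |: (y |: [set x])) set0 H * forest_mass beta [set x] set0 H =
  forest_mass beta (y |: [set x]) set0 H * forest_mass beta (z |: [set x]) set0 H.
Proof.
move=> yz.
have E A p1 p2 : (forall F, F \subset H ->
      separated A F = p1 (F :&: H1) && p2 (F :&: H2)) ->
    forest_mass beta A set0 H = mass p1 H1 * mass p2 H2.
  move=> h; rewrite -mass_cut; apply: eq_bigl => F; rewrite sub0set /=.
  by have [/h->|] := boolP (F \subset H).
rewrite (E _ (fun F => ~~ conn F x y) (fun F => ~~ conn F x z)) => [|F sFH]; last first.
  exact: separated_cut.
rewrite (E _ xpredT xpredT) => [|F sFH]; last by rewrite separated1.
rewrite (E _ (fun F => ~~ conn F x y) xpredT) => [|F sFH]; last first.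
  by rewrite separated_pair // conn_side1 // andbT.
rewrite (E _ xpredT (fun F => ~~ conn F x z)) => [|F sFH]; last first.
  by rewrite separated_pair // conn_side2.
by ring.
Qed.
End CutVertex.

(** * The key inequality for large beta, and expansion over two edges *)

Section GasFormulas.
Variables (K : realFieldType) (G : graph).
Implicit Types (x y z : vertex G) (e : edge G) (F H S : {set edge G}).
Implicit Types (A : {set vertex G}) (beta : K).

Lemma forest_mass_ge0 beta A S H : 0 <= beta -> 0 <= forest_mass beta A S H.
Proof. by move=> b0; apply: sumr_ge0 => F _; rewrite exprn_ge0. Qed.

Lemma forest_mass_sub beta A (B : {set vertex G}) S H : 0 <= beta -> A \subset B ->
  forest_mass beta B S H <= forest_mass beta A S H.
Proof.
move=> b0 /subsetP sAB; rewrite /forest_mass /forest_sum.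
rewrite [leRHS](bigID (separated B)) /= [X in X <= _](_ : _ = \sum_(F | [&&
  F \in forests G, S \subset F, F \subset H & separated A F] && separated B F)
  beta ^+ #|F|).
  by rewrite lerDl; apply: sumr_ge0 => F _; rewrite exprn_ge0.
apply: eq_bigl => F; rewrite -!andbA; do 3!congr (_ && _).
have [/separatedP sB|] := boolP (separated B F); last by rewrite andbF.
rewrite andbT; apply/esym/separatedP => u v /sAB uB /sAB vB; exact: sB.
Qed.

Lemma forest_mass_nconn beta x y H : x != y -> ~~ conn H x y ->
  forest_mass beta (y |: [set x]) set0 H = forest_mass beta [set x] set0 H.
Proof.
move=> xy nxy; apply: eq_bigl => F; rewrite separated1 separated_pair //.
have [sFH|] := boolP (F \subset H); last by rewrite !andbF.
by congr [&& _, _ & _]; rewrite (contra _ nxy) //; apply: conn_sub.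
Qed.

Lemma forest_mass_edge beta A S H e r v :
    e \in H -> e \notin S -> joins e r v -> r \in A -> v \notin A ->
  forest_mass beta A (e |: S) H = beta * forest_mass beta (v |: A) S (H :\ e).
Proof.
move=> eH eS erv rA vA; rewrite /forest_mass (forest_sum_edge _ eH eS erv rA vA).
by rewrite /forest_sum mulr_sumr; apply: eq_bigr => F _; rewrite /= exprS.
Qed.

(** Deleting two edges may disconnect the graph, so connectedness of [H] is assumed conditionally:
    once [x], [y], [z] are joined in [H], the deleted edges can be bypassed. *)
Lemma negative_correlation_eventually H x y z : x != y -> x != z -> y != z ->
    (conn H x y -> conn H y z -> forall u, conn H u x) ->
  exists b : K, forall beta, 0 <= beta -> b <= beta ->
    forest_mass beta (z |: (y |: [set x])) set0 H * forest_mass beta [set x] set0 H <=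
    forest_mass beta (y |: [set x]) set0 H * forest_mass beta (z |: [set x]) set0 H.
Proof.
move=> xy xz yz hc.
have [xyH|xyH] := boolP (conn H x y); last first.
  exists 0 => beta b0 _; rewrite (forest_mass_nconn beta xy xyH) mulrC.
  apply: ler_wpM2l; first exact: forest_mass_ge0.
  by apply: forest_mass_sub => //; apply/setUS/subsetUr.
have [cyz|cyz] := boolP (conn (avoiding H x) y z); last first.
  by exists 0 => beta _ _; rewrite (forest_mass_cut xy xz cyz).
have yzH : conn H y z.
  by apply: conn_sub cyz; apply/subsetP => e; rewrite inE => /andP[].
have [b hb] := forest_mass_eventually K xy xz yz (hc xyH yzH) cyz.
by exists b => beta _; apply: hb.
Qed.

Lemma forest_mass_gt0 beta x : 0 < beta -> 0 < forest_mass beta [set x] set0 setT.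
Proof.
move=> b0; rewrite /forest_mass /forest_sum (bigD1 set0) /=; last first.
  by rewrite in_forests !sub0set separated1 /= andbT; apply/asboolP/is_forest0.
rewrite cards0 ltr_pwDl //; apply: sumr_ge0 => F _; exact: exprn_ge0 (ltW b0).
Qed.

(** Each edge is either deleted or contracted towards [x]; a contraction yields a factor [beta] and
    a new root. *)
Lemma forest_mass_pair beta x y z e1 e2 : e1 != e2 -> joins e1 x y -> joins e2 x z ->
    x != y -> x != z -> y != z -> let H := setT :\ e1 :\ e2 in
  [/\ forest_mass beta [set x] set0 setT =
        forest_mass beta [set x] set0 H + beta * forest_mass beta (z |: [set x]) set0 H +
        beta * (forest_mass beta (y |: [set x]) set0 H +
          beta * forest_mass beta (z |: (y |: [set x])) set0 H),
      forest_mass beta [set x] [set e1] setT =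
        beta * (forest_mass beta (y |: [set x]) set0 H +
          beta * forest_mass beta (z |: (y |: [set x])) set0 H),
      forest_mass beta [set x] [set e2] setT =
        beta * (forest_mass beta (z |: [set x]) set0 H +
          beta * forest_mass beta (z |: (y |: [set x])) set0 H) &
      forest_mass beta [set x] [set e1; e2] setT =
        beta * (beta * forest_mass beta (z |: (y |: [set x])) set0 H)].
Proof.
move=> e12 exy exz xy xz yz H.
have add_edge A S e H' : e \notin S -> forest_mass beta A S H' =
    forest_mass beta A S (H' :\ e) + forest_mass beta A (e |: S) H'.
  exact: forest_sum_split.
have use_edge A e r v H' : e \in H' -> joins e r v -> r \in A -> v \notin A ->
    forest_mass beta A [set e] H' = beta * forest_mass beta (v |: A) set0 (H' :\ e).
  move=> eH' erv rA vA; rewrite -{1}[[set e]]setU0.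
  by rewrite (forest_mass_edge _ eH' _ erv rA vA) ?inE.
have HC : setT :\ e2 :\ e1 = H by rewrite /H !setDDl setUC.
have yx : y \notin [set x] by rewrite inE eq_sym.
have zx : z \notin [set x] by rewrite inE eq_sym.
have zyx : z \notin y |: [set x] by rewrite !inE negb_or eq_sym yz eq_sym.
have yzx : y \notin z |: [set x] by rewrite !inE negb_or yz eq_sym.
have e2H : e2 \in setT :\ e1 by rewrite !inE eq_sym e12.
have e1H : e1 \in setT :\ e2 by rewrite !inE e12.
have xA v : x \in v |: [set x] by rewrite setU1r ?set11.
have E1 : forest_mass beta [set x] [set e1] setT =
    beta * (forest_mass beta (y |: [set x]) set0 H +
      beta * forest_mass beta (z |: (y |: [set x])) set0 H).
  rewrite (use_edge _ _ _ _ _ (in_setT e1) exy (set11 x) yx).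
  by rewrite (add_edge _ set0 e2) ?inE // setU0 (use_edge _ _ _ _ _ e2H exz (xA y) zyx).
have E2 : forest_mass beta [set x] [set e2] setT =
    beta * (forest_mass beta (z |: [set x]) set0 H +
      beta * forest_mass beta (z |: (y |: [set x])) set0 H).
  rewrite (use_edge _ _ _ _ _ (in_setT e2) exz (set11 x) zx).
  rewrite (add_edge _ set0 e1) ?inE // setU0 (use_edge _ _ _ _ _ e1H exy (xA z) yzx).
  by rewrite HC setUCA.
split=> //.
  rewrite (add_edge _ set0 e1) ?inE // setU0 E1; congr (_ + _).
  by rewrite (add_edge _ set0 e2) ?inE // setU0 (use_edge _ _ _ _ _ e2H exz (set11 x) zx).
rewrite (forest_mass_edge _ (in_setT e1) _ exy (set11 x) yx) ?inE //.
by rewrite (use_edge _ _ _ _ _ e2H exz (xA y) zyx).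
Qed.

Lemma forest_mass0 beta A S H :
  (forall F, S \subset F -> ~ is_forest F) -> forest_mass beta A S H = 0.
Proof.
by move=> h; apply: big1 => F; rewrite in_forests => /and4P[/asboolP fF /h].
Qed.

(** The excluded coincidences are the loops and the parallel pair, which are cycles of length one
    and two. *)
Lemma is_forest_no_triangle F e1 e2 x y z : e1 != e2 -> joins e1 x y -> joins e2 x z ->
  e1 \in F -> e2 \in F -> is_forest F -> [&& x != y, x != z & y != z].
Proof.
move=> e12 exy exz e1F e2F fF.
have nc e u v : e \in F -> joins e u v -> ~~ conn (F :\ e) u v.
  by move=> eF euv; apply: (is_forest_nconn (e := e)); rewrite ?setD11 ?setD1K.
have xy := nc _ _ _ e1F exy; have xz := nc _ _ _ e2F exz; apply/and3P; split.
- by apply: contraNneq xy => ->; rewrite conn_refl.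
- by apply: contraNneq xz => ->; rewrite conn_refl.
apply: contraNneq xy => ->; apply: conn_edge exz.
by rewrite !inE e2F eq_sym e12.
Qed.
End GasFormulas.

(** * Edge probabilities as ratios, and the choice of a uniform threshold *)

Section Probabilities.
Variables (R : realType) (G : graph).
Implicit Types (x y z : vertex G) (e : edge G) (beta : R).

(** A single root is always separated; it is inserted so that edges at [x] can be contracted towards
    it. *)
Lemma prob_edgesE beta S x :
  prob_edges beta S =
  forest_mass beta [set x] S setT / forest_mass beta [set x] set0 setT.
Proof.
have -> : forest_mass beta [set x] set0 setT = partition_function G beta.
  by apply: eq_bigl => F; rewrite sub0set subsetT separated1 !andbT.
rewrite /forest_mass /forest_sum mulr_suml /prob_edges /gas_prob /gas_mass.
rewrite -big_mkcondr; apply: eq_bigl => F.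
by rewrite inE subsetT separated1 !andbT andbC.
Qed.

Lemma adjacent_joins e1 e2 : adjacent e1 e2 ->
  exists x y z, joins e1 x y /\ joins e2 x z.
Proof.
case/set0Pn => x /setIP[].
have other e : x \in ends e -> exists y, joins e x y.
  have [u [v euv]] := ends_joins e; rewrite (eqP euv) => /set2P[]->.
    by exists v.
  by exists u; rewrite joinsC.
by move=> /other[y exy] /other[z exz]; exists x, y, z.
Qed.

Lemma prob_edges_eventually e1 e2 : connected_graph G -> e1 != e2 -> adjacent e1 e2 ->
  exists b : R, forall beta, 0 < beta -> b <= beta ->
    prob_edges beta [set e1; e2] <= prob_edges beta [set e1] * prob_edges beta [set e2].
Proof.
move=> cG e12 /adjacent_joins[x [y [z [exy exz]]]].
have [/and3P[xy xz yz]|ntri] := boolP [&& x != y, x != z & y != z]; last first.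
  (* With a loop or a parallel pair no forest contains both edges, so the left-hand side is 0. *)
  exists 0 => beta b0 _; rewrite !(prob_edgesE _ _ x).
  rewrite [X in X / _ <= _]forest_mass0 ?mul0r.
    by apply: mulr_ge0; apply: divr_ge0; apply/forest_mass_ge0/ltW.
  move=> F; rewrite subUset !sub1set => /andP[e1F e2F] fF.
  by case/negP: ntri; apply: is_forest_no_triangle exy exz e1F e2F fF.
pose H := setT :\ e1 :\ e2.
have conH : conn H x y -> conn H y z -> forall u, conn H u x.
  move=> cxy cyz u; have cxz := conn_trans cxy cyz.
  apply: (connect_sub _ (cG u x)) => a b /existsP[e eab].
  have [e_e1|ne1] := eqVneq e e1.
    rewrite e_e1 in eab; case: (joins_eq exy eab) => -[-> ->] //.
    by have := cxy; rewrite connC.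
  have [e_e2|ne2] := eqVneq e e2.
    rewrite e_e2 in eab; case: (joins_eq exz eab) => -[-> ->] //.
    by have := cxz; rewrite connC.
  by apply: conn_edge eab; rewrite !inE ne1 ne2.
have [b hb] := negative_correlation_eventually R xy xz yz conH.
exists b => beta b0 /(hb _ (ltW b0)) le; rewrite !(prob_edgesE _ _ x).
have Z0 := forest_mass_gt0 x b0.
have [EZ -> -> ->] := forest_mass_pair beta e12 exy exz xy xz yz.
rewrite mulf_div ler_pdivlMr ?mulr_gt0 // [leLHS]mulrA mulfVK ?gt_eqF // {Z0}EZ -/H.
move: le; set p := forest_mass _ [set x] _ _; set a := forest_mass _ (y |: [set x]) _ _.
set c := forest_mass _ (z |: [set x]) _ _; set s := forest_mass _ _ _ _ => le.
(* After clearing denominators, all terms of order above [beta ^+ 2] cancel. *)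
rewrite -subr_ge0 [X in 0 <= X](_ : _ = beta ^+ 2 * (a * c - s * p)); last by ring.
by rewrite mulr_ge0 ?subr_ge0 // exprn_ge0 // ltW.
Qed.
End Probabilities.

Theorem theorem2p1 (R : realType) (G : graph) (hG : connected_graph G) :
  exists beta0 : R, 0 < beta0 /\
    forall beta : R, beta0 <= beta ->
    forall e1 e2 : edge G, e1 != e2 -> adjacent e1 e2 ->
      prob_edges beta [set e1; e2] <=
        prob_edges beta [set e1] * prob_edges beta [set e2].
Proof.
have bound (q : edge G * edge G) : exists b : R, forall beta, 0 < beta -> b <= beta ->
    q.1 != q.2 -> adjacent q.1 q.2 ->
    prob_edges beta [set q.1; q.2] <= prob_edges beta [set q.1] * prob_edges beta [set q.2].
  have [/andP[ne ad]|/negP nad] := boolP ((q.1 != q.2) && adjacent q.1 q.2).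
    by have [b hb] := prob_edges_eventually R hG ne ad; exists b => beta ? ? _ _; apply: hb.
  by exists 0 => beta _ _ ne ad; case: nad; rewrite ne.
have [b hb] := choice bound.
have S0 : 0 <= \sum_q `|b q| by apply: sumr_ge0.
(* The sum over the finitely many pairs dominates every threshold [b q], and the 1 makes it
   positive. *)
exists (1 + \sum_q `|b q|); split; first exact: ltr_pwDl.
move=> beta le e1 e2; apply: (hb (e1, e2)).
  by apply: lt_le_trans le; apply: ltr_pwDl.
apply: le_trans le; apply: (le_trans (ler_norm _)).
rewrite (bigD1 (e1, e2)) //= addrCA lerDl addr_ge0 //; exact: sumr_ge0.
Qed.
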